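(* Let $K$ be a field of characteristic $0$ and let $q\in K^\times$ be not a root of unity. Let $A=K[h](a,\sigma)$, $\sigma(h)=qh$, be a generalized Weyl algebra of quantum type of degree $1$. Then the ideals of $\mathbb{Z}$-graded identities satisfy $$T_{\mathbb{Z}}(A)=T_{\mathbb{Z}}(\mathcal{S}_1(q))=T_{\mathbb{Z}}(K_q[x,y]).$$
   Context: For a ring $D$, an automorphism $\sigma$ of $D$ and a nonzero central element $a\in D$, the degree $1$ generalized Weyl algebra $D(a,\sigma)$ is generated over $D$ by $X^+,X^-$ with relations $X^+d=\sigma(d)X^+$, $X^-d=\sigma^{-1}(d)X^-$ for $d\in D$, $X^-X^+=a$, $X^+X^-=\sigma(a)$. It is of quantum type if $D=K[h]$ is the polynomial ring in one variable and $\sigma$ is the $K$-automorphism with $\sigma(h)=qh$. Its $\mathbb{Z}$-grading is $D(a,\sigma)=\bigoplus_{n}Dz^n$ with $z^n=(X^+)^n$ for $n\ge0$ and $z^n=(X^-)^{-n}$ for $n<0$. $\mathcal{S}_1(q)=K(h)*\mathbb{Z}=\bigoplus_{n\in\mathbb{Z}}K(h)\varepsilon^n$ is the skew group algebra in which the free generator $\varepsilon$ of $\mathbb{Z}$ acts on $K(h)$ by $\varepsilon(h)=qh$ (so $\varepsilon f(h)=f(qh)\varepsilon$); $K(h)\varepsilon^n$ has degree $n$. The quantum plane $K_q[x,y]$ is $K\langle x,y\rangle$ modulo $yx-qxy=0$, $\mathbb{Z}$-graded with degree $n$ component $K[xy]y^n$ for $n\ge0$ and $K[xy]x^{-n}$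 for $n<0$. $K\langle X\mid\mathbb{Z}\rangle$ is the free unital associative $K$-algebra on a disjoint union $X=\bigcup_{n\in\mathbb{Z}}X_n$ of countably infinite sets, the variables in $X_n$ having degree $n$. For a $\mathbb{Z}$-graded algebra $B$, $T_{\mathbb{Z}}(B)$ is the ideal of all $f\in K\langle X\mid\mathbb{Z}\rangle$ vanishing under every substitution of each variable by a homogeneous element of $B$ of the same degree. *)

(* Defs.v *)
From HB Require Import structures.
From mathcomp Require Import all_boot all_order all_algebra.
From mathcomp Require Import generic_quotient ring_quotient fraction.
From mathcomp Require Import finmap boolp classical_sets.
From mathcomp Require Import monalg.

Set Implicit Arguments.
Unset Strict Implicit.
Unset Printing Implicit Defensive.

Import GRing.Theory.
Local Open Scope ring_scope.

(* An alias, because the library makes {malg K[M]} a K-algebra (algType) only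
   for commutative monoids M. *)
Definition freeAlg (K : fieldType) (X : choiceType) : Type :=
  {malg K[{fmonom X}]}.

Section FreeAlg.
Variables (K : fieldType) (X : choiceType).

HB.instance Definition _ := GRing.Lalgebra.on (freeAlg K X).

Fact freeAlg_scaleAr (c : K) (u v : freeAlg K X) :
  c *: (u * v) = u * (c *: v).
Proof.
have le_cv := @msuppZ_le _ K c v.
apply/malgP => k; rewrite mcoeffZ [in LHS]mcoeffMl.
rewrite [RHS](mcoeffMlw k (fsubset_refl (msupp u)) le_cv).
rewrite mulr_sumr; apply: eq_bigr => i _.
rewrite mulr_sumr; apply: eq_bigr => j _.
by rewrite mcoeffZ mulrnAr mulrCA.
Qed.

HB.instance Definition _ :=
  GRing.Lalgebra_isAlgebra.Build K (freeAlg K X) freeAlg_scaleAr.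

Definition fgen (x : X) : freeAlg K X := << fmu x >>.

Variables (B : algType K) (phi : X -> B).

Definition feval (f : freeAlg K X) : B :=
  mmap (in_alg B) (fun m : {fmonom X} => \prod_(x <- (m : seq X)) phi x) f.

Fact feval_zmod_morphism : zmod_morphism feval.
Proof. by move=> u v; rewrite /feval raddfB. Qed.

HB.instance Definition _ :=
  GRing.isZmodMorphism.Build (freeAlg K X) B feval feval_zmod_morphism.

Fact feval_scalable : scalable feval.
Proof.
move=> c u; rewrite /feval (mmapEw (msuppZ_le c u)) mmapE scaler_sumr.
by apply: eq_bigr => m _; rewrite mcoeffZ /= -scalerA scalerAl.
Qed.

HB.instance Definition _ :=
  GRing.isScalable.Build K (freeAlg K X) B *:%R feval feval_scalable.

Fact feval_monoid_morphism : monoid_morphism feval.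
Proof.
have mulU (m n : {fmonom X}) : \prod_(x <- (mmul m n : seq X)) phi x
    = (\prod_(x <- (m : seq X)) phi x) * \prod_(x <- (n : seq X)) phi x.
  by rewrite fmM big_cat.
split=> [|u v]; first by rewrite /feval mmapU fm1 big_nil mulr1 /= scale1r.
rewrite /feval malgME raddf_sum mulr_suml /=; apply: eq_bigr => m _.
rewrite raddf_sum mulr_sumr /=; apply: eq_bigr => n _.
by rewrite mmapU mulU /= !mulr_algl -scalerAl -scalerAr scalerA.
Qed.

HB.instance Definition _ :=
  GRing.isMonoidMorphism.Build (freeAlg K X) B feval feval_monoid_morphism.

Lemma feval1 : feval 1 = 1. Proof. exact: rmorph1. Qed.
Lemma fevalB u v : feval (u - v) = feval u - feval v.
Proof. exact: rmorphB. Qed.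
Lemma fevalD u v : feval (u + v) = feval u + feval v.
Proof. exact: rmorphD. Qed.
Lemma fevalM u v : feval (u * v) = feval u * feval v.
Proof. exact: rmorphM. Qed.

Lemma feval_gen x : feval (fgen x) = phi x.
Proof. by rewrite /feval mmapU fmU big_seq1 /= scale1r mul1r. Qed.

End FreeAlg.

Inductive ideal_gen (K : fieldType) (A : algType K) (S : set A) : A -> Prop :=
| ideal_gen0 : ideal_gen S 0
| ideal_genD a s b u : S s -> ideal_gen S u -> ideal_gen S (a * s * b + u).

Section IdealGen.
Variables (K : fieldType) (A : algType K) (S : set A).

Lemma ideal_gen_in s : S s -> ideal_gen S s.
Proof.
by move=> Ss; rewrite -[s]addr0 -[s]mulr1 -[s]mul1r; do ?constructor.
Qed.

Fact ideal_gen_add u v : ideal_gen S u -> ideal_gen S v -> ideal_gen S (u + v).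
Proof.
elim=> [|a s b {}u Ss _ IH] Iv; first by rewrite add0r.
by rewrite -addrA; constructor=> //; apply: IH.
Qed.

Fact ideal_gen_mul x y u : ideal_gen S u -> ideal_gen S (x * u * y).
Proof.
elim=> [|a s b {}u Ss _ IH]; first by rewrite mulr0 mul0r; constructor.
rewrite mulrDr mulrDl (_ : x * (a * s * b) * y = (x * a) * s * (b * y)).
  by constructor.
by rewrite !mulrA.
Qed.

Fact ideal_gen_mull x u : ideal_gen S u -> ideal_gen S (x * u).
Proof. by move=> /(ideal_gen_mul x 1); rewrite mulr1. Qed.

Fact ideal_gen_mulr x u : ideal_gen S u -> ideal_gen S (u * x).
Proof. by move=> /(ideal_gen_mul 1 x); rewrite mul1r. Qed.

Lemma ideal_gen_min (B : algType K) (f : {lrmorphism A -> B}) :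
  (forall s, S s -> f s = 0) -> forall u, ideal_gen S u -> f u = 0.
Proof.
move=> f0 u; elim=> [|a s b {}u Ss _ IH]; first exact: raddf0.
by rewrite rmorphD !rmorphM /= IH (f0 s Ss) mulr0 mul0r addr0.
Qed.

Definition ideal_pred : {pred A} := fun u => `[< ideal_gen S u >].

Fact ideal_zmod_closed : zmod_closed ideal_pred.
Proof.
split=> [|u v /asboolP Iu /asboolP Iv]; apply/asboolP; first by constructor.
by apply: ideal_gen_add => //; rewrite -mulN1r; apply: ideal_gen_mull.
Qed.

HB.instance Definition _ :=
  GRing.isZmodClosed.Build A ideal_pred ideal_zmod_closed.

(* Algebras (algType) are nontrivial by definition, hence the argument that the
   ideal is proper. *)
Definition quotAlg of ~ ideal_gen S 1 : Type := Quotient.quot ideal_pred.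

Variable nt : ~ ideal_gen S 1.
Local Notation Q := (quotAlg nt).

HB.instance Definition _ := GRing.Zmodule.on Q.

Definition qpi (u : A) : Q := \pi_(Quotient.quot ideal_pred)%qT u.

Lemma qpi_surj (x : Q) : exists u, x = qpi u.
Proof.
by exists (repr (x : Quotient.quot ideal_pred)); rewrite /qpi reprK.
Qed.

Lemma qpi_eq u v : (qpi u = qpi v) <-> ideal_gen S (u - v).
Proof.
split=> [/eqP|/asboolP Iuv]; last apply/eqP;
by rewrite /qpi -Quotient.idealrBE // => /asboolP.
Qed.

Fact qpi_zmod_morphism : zmod_morphism qpi.
Proof. by move=> u v; rewrite /qpi !piE. Qed.

HB.instance Definition _ :=
  GRing.isZmodMorphism.Build A Q qpi qpi_zmod_morphism.

Let lift (x : Q) : A := repr (x : Quotient.quot ideal_pred).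

Let liftK x : qpi (lift x) = x.
Proof. by rewrite /qpi /lift reprK. Qed.

Let qpi_lift u : ideal_gen S (lift (qpi u) - u).
Proof. by apply/qpi_eq; rewrite liftK. Qed.

Definition qone : Q := qpi 1.
Definition qmul (x y : Q) : Q := qpi (lift x * lift y).
Definition qscale (c : K) (x : Q) : Q := qpi (c *: lift x).

Let qpiM u v : qmul (qpi u) (qpi v) = qpi (u * v).
Proof.
apply/qpi_eq; set u' := lift _; set v' := lift _.
rewrite (_ : _ - _ = (u' - u) * v' + u * (v' - v)).
  apply: ideal_gen_add; first exact/ideal_gen_mulr/qpi_lift.
  exact/ideal_gen_mull/qpi_lift.
by rewrite mulrBl mulrBr addrA subrK.
Qed.

Let qpiZ c u : qscale c (qpi u) = qpi (c *: u).
Proof.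
apply/qpi_eq; rewrite -scalerBr -mulr_algl.
exact/ideal_gen_mull/qpi_lift.
Qed.

Fact qmulA : associative qmul.
Proof.
move=> x y z; rewrite -(liftK x) -(liftK y) -(liftK z).
by rewrite !qpiM mulrA.
Qed.

Fact qmul1 : left_id qone qmul.
Proof. by move=> x; rewrite -(liftK x) qpiM mul1r. Qed.

Fact qmulr1 : right_id qone qmul.
Proof. by move=> x; rewrite -(liftK x) qpiM mulr1. Qed.

Fact qmulDl : left_distributive qmul +%R.
Proof.
move=> x y z; rewrite -(liftK x) -(liftK y) -(liftK z).
by rewrite -raddfD !qpiM mulrDl raddfD.
Qed.

Fact qmulDr : right_distributive qmul +%R.
Proof.
move=> x y z; rewrite -(liftK x) -(liftK y) -(liftK z).
by rewrite -raddfD !qpiM mulrDr raddfD.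
Qed.

Fact qone_neq0 : qone != 0.
Proof.
apply/negP => /eqP; rewrite -(raddf0 qpi) => /qpi_eq; rewrite subr0.
exact: nt.
Qed.

HB.instance Definition _ := GRing.Zmodule_isNzRing.Build Q
  qmulA qmul1 qmulr1 qmulDl qmulDr qone_neq0.

Fact qscaleA c d x : qscale c (qscale d x) = qscale (c * d) x.
Proof. by rewrite -(liftK x) !qpiZ scalerA. Qed.

Fact qscale1 : left_id 1 qscale.
Proof. by move=> x; rewrite -(liftK x) qpiZ scale1r. Qed.

Fact qscaleDr : right_distributive qscale +%R.
Proof.
move=> c x y; rewrite -(liftK x) -(liftK y).
by rewrite -raddfD !qpiZ scalerDr raddfD.
Qed.

Fact qscaleDl x : {morph qscale^~ x : c d / c + d}.
Proof. by move=> c d; rewrite -(liftK x) !qpiZ scalerDl raddfD. Qed.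

HB.instance Definition _ := GRing.Zmodule_isLmodule.Build K Q
  qscaleA qscale1 qscaleDr qscaleDl.

Fact qscaleAl (c : K) (x y : Q) : c *: (x * y) = (c *: x) * y.
Proof.
rewrite -(liftK x) -(liftK y) /GRing.scale/= /GRing.mul/=.
by rewrite qpiM !qpiZ qpiM scalerAl.
Qed.

HB.instance Definition _ := GRing.Lmodule_isLalgebra.Build K Q qscaleAl.

Fact qscaleAr (c : K) (x y : Q) : c *: (x * y) = x * (c *: y).
Proof.
rewrite -(liftK x) -(liftK y) /GRing.scale/= /GRing.mul/=.
by rewrite qpiM !qpiZ qpiM scalerAr.
Qed.

HB.instance Definition _ := GRing.Lalgebra_isAlgebra.Build K Q qscaleAr.

Fact qpi_monoid_morphism : monoid_morphism qpi.
Proof. by split=> // u v; rewrite -qpiM. Qed.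

HB.instance Definition _ :=
  GRing.isMonoidMorphism.Build A Q qpi qpi_monoid_morphism.

Fact qpi_scalable : scalable qpi.
Proof. by move=> c u; rewrite -qpiZ. Qed.

HB.instance Definition _ := GRing.isScalable.Build K A Q *:%R qpi qpi_scalable.

End IdealGen.

Record kaut (K : fieldType) (D : algType K) := KAut {
  kaut_fun :> {lrmorphism D -> D};
  kaut_inv : D -> D;
  kautK : cancel kaut_fun kaut_inv;
  kautVK : cancel kaut_inv kaut_fun
}.

Section KAut.
Variables (K : fieldType) (D : algType K) (s : kaut D).

HB.instance Definition _ := GRing.isZmodMorphism.Build D D (kaut_inv s)
  (can2_zmod_morphism (kautK s) (kautVK s)).
HB.instance Definition _ := GRing.isMonoidMorphism.Build D D (kaut_inv s)
  (can2_monoid_morphism (kautK s) (kautVK s)).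
HB.instance Definition _ := GRing.isScalable.Build K D D *:%R (kaut_inv s)
  (can2_scalable (kautK s) (kautVK s)).

Definition kaut_pow (n : int) : D -> D :=
  match n with
  | Posz m => iter m s
  | Negz m => iter m.+1 (kaut_inv s)
  end.

Fact kaut_pow_zmod_morphism n : zmod_morphism (kaut_pow n).
Proof.
by case: n => n u v; rewrite /kaut_pow; [elim: n | elim: n.+1] => //= m ->;
  rewrite raddfB.
Qed.

HB.instance Definition _ n := GRing.isZmodMorphism.Build D D (kaut_pow n)
  (kaut_pow_zmod_morphism n).

Fact kaut_pow_monoid_morphism n : monoid_morphism (kaut_pow n).
Proof.
split=> [|u v]; first by case: n => n; apply: iter_fix; rewrite rmorph1.
by case: n => n; rewrite /kaut_pow; [elim: n | elim: n.+1] => //= m ->;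
  rewrite rmorphM.
Qed.

HB.instance Definition _ n := GRing.isMonoidMorphism.Build D D (kaut_pow n)
  (kaut_pow_monoid_morphism n).

Fact kaut_pow_scalable n : scalable (kaut_pow n).
Proof.
by case: n => n c u; rewrite /kaut_pow; [elim: n | elim: n.+1] => //= m ->;
  rewrite linearZ.
Qed.

HB.instance Definition _ n := GRing.isScalable.Build K D D *:%R (kaut_pow n)
  (kaut_pow_scalable n).

Lemma kaut_powS n d : kaut_pow (1 + n) d = s (kaut_pow n d).
Proof.
case: n => [n|[|n]] //; first by rewrite /= kautVK.
rewrite (_ : 1 + Negz n.+1 = Negz n) /= ?kautVK //.
by rewrite !NegzE -[n.+2]addn1 PoszD opprD addrCA subrr addr0.
Qed.

Lemma kaut_powV n d : kaut_pow (n - 1) d = kaut_inv s (kaut_pow n d).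
Proof. by rewrite -[n in RHS](subrK 1) [_ + 1]addrC kaut_powS kautK. Qed.

Lemma kaut_powD m n d : kaut_pow (m + n) d = kaut_pow m (kaut_pow n d).
Proof.
elim: m => [|m IH|m IH]; first by rewrite add0r.
  by rewrite intS -addrA !kaut_powS IH.
by rewrite -addn1 PoszD opprD addrAC !kaut_powV IH.
Qed.

End KAut.

(* The sum of the d_n e^n is the finitely supported function n |-> d_n, and
   (d e^m) (d' e^n) = d s^m(d') e^(m + n). *)
Definition skewZ (K : fieldType) (D : algType K) of kaut D : Type :=
  {malg D[int]}.

Section SkewZ.
Variables (K : fieldType) (D : algType K) (s : kaut D).
Local Notation R := (skewZ s).
Local Notation pw := (kaut_pow s).

HB.instance Definition _ := GRing.Zmodule.on R.

(* d e^n *)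
Definition skewU (d : D) (n : int) : R := << d *g n >>.

Definition skew_mul (u v : R) : R :=
  \sum_(m <- msupp u) \sum_(n <- msupp v) skewU (u@_m * pw m v@_n) (m + n).

Definition skew_one : R := skewU 1 0.
Definition skew_scale (c : K) (u : R) : R := c%:A *: (u : {malg D[int]}).

Fact skewU0 n : skewU 0 n = 0. Proof. exact: monalgU0. Qed.
Fact skewUD n x y : skewU (x + y) n = skewU x n + skewU y n.
Proof. exact: monalgUD. Qed.

Fact skew_mulEw (d1 d2 : {fset int}) (u v : R) :
  (msupp u `<=` d1)%fset -> (msupp v `<=` d2)%fset ->
  skew_mul u v
    = \sum_(m <- d1) \sum_(n <- d2) skewU (u@_m * pw m v@_n) (m + n).
Proof.
move=> le1 le2; rewrite /skew_mul (big_fset_incl _ le1) /=.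
  apply/eq_bigr=> m _; apply/big_fset_incl => // n _ /mcoeff_outdom ->.
  by rewrite raddf0 mulr0 skewU0.
move=> m _ /mcoeff_outdom um.
by rewrite big1 // => n _; rewrite um mul0r skewU0.
Qed.

Fact skew_mulUU c d m n :
  skew_mul (skewU c m) (skewU d n) = skewU (c * pw m d) (m + n).
Proof.
by rewrite (skew_mulEw msuppU_le msuppU_le) !big_seq_fset1 !mcoeffUU.
Qed.

Fact skew_mulDl : left_distributive skew_mul +%R.
Proof.
move=> u v w; rewrite (skew_mulEw (msuppD_le u v) (fsubset_refl (msupp w))).
rewrite (skew_mulEw (fsubsetUl (msupp u) (msupp v)) (fsubset_refl (msupp w))).
rewrite (skew_mulEw (fsubsetUr (msupp u) (msupp v)) (fsubset_refl (msupp w))).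
rewrite -big_split; apply: eq_bigr => m _ /=.
rewrite -big_split; apply: eq_bigr => n _ /=.
by rewrite mcoeffD mulrDl skewUD.
Qed.

Fact skew_mulDr : right_distributive skew_mul +%R.
Proof.
move=> w u v; rewrite (skew_mulEw (fsubset_refl (msupp w)) (msuppD_le u v)).
rewrite (skew_mulEw (fsubset_refl (msupp w)) (fsubsetUl (msupp u) (msupp v))).
rewrite (skew_mulEw (fsubset_refl (msupp w)) (fsubsetUr (msupp u) (msupp v))).
rewrite -big_split; apply: eq_bigr => m _ /=.
rewrite -big_split; apply: eq_bigr => n _ /=.
by rewrite mcoeffD raddfD mulrDr skewUD.
Qed.

Fact skew_mul0l u : skew_mul 0 u = 0.
Proof. by rewrite /skew_mul msupp0 big_seq_fset0. Qed.

Fact skew_mul0r u : skew_mul u 0 = 0.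
Proof. by rewrite /skew_mul big1 // => m _; rewrite msupp0 big_seq_fset0. Qed.

Fact skewE (u : R) : u = \sum_(m <- msupp u) skewU u@_m m.
Proof. exact: monalgE. Qed.

Fact skew_ind (P : R -> Prop) : P 0 ->
  (forall d n u, P u -> P (skewU d n + u)) -> forall u, P u.
Proof.
move=> P0 PD u; rewrite (skewE u); elim: (enum_fset _) => [|m r IH].
  by rewrite big_nil.
by rewrite big_cons; apply: PD.
Qed.

Fact skew_mulA : associative skew_mul.
Proof.
elim/skew_ind=> [|a m u IHu] v w; first by rewrite !skew_mul0l.
rewrite !skew_mulDl IHu; congr (_ + _); elim/skew_ind: v w => [|b n v IHv] w.
  by rewrite skew_mul0l skew_mul0r skew_mul0l.
rewrite skew_mulDl !skew_mulDr skew_mulDl IHv; congr (_ + _).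
elim/skew_ind: w => [|c p w IHw]; first by rewrite !skew_mul0r.
rewrite !skew_mulDr IHw; congr (_ + _).
by rewrite !skew_mulUU kaut_powD rmorphM mulrA addrA.
Qed.

Fact skew_mul1l : left_id skew_one skew_mul.
Proof.
move=> u; elim/skew_ind: u => [|a m u IHu]; first exact: skew_mul0r.
by rewrite skew_mulDr IHu skew_mulUU mul1r add0r.
Qed.

Fact skew_mul1r : right_id skew_one skew_mul.
Proof.
move=> u; elim/skew_ind: u => [|a m u IHu]; first exact: skew_mul0l.
by rewrite skew_mulDl IHu skew_mulUU rmorph1 mulr1 addr0.
Qed.

Fact skew_one_neq0 : skew_one != 0.
Proof. by rewrite monalgU_eq0 oner_eq0. Qed.

HB.instance Definition _ := GRing.Zmodule_isNzRing.Build R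
  skew_mulA skew_mul1l skew_mul1r skew_mulDl skew_mulDr skew_one_neq0.

Fact skew_scaleA c d x : skew_scale c (skew_scale d x) = skew_scale (c * d) x.
Proof. by rewrite /skew_scale scalerA -scalerAl mul1r scalerA. Qed.

Fact skew_scale1 : left_id 1 skew_scale.
Proof. by move=> x; rewrite /skew_scale !scale1r. Qed.

Fact skew_scaleDr : right_distributive skew_scale +%R.
Proof. by move=> c x y; rewrite /skew_scale scalerDr. Qed.

Fact skew_scaleDl x : {morph skew_scale^~ x : c d / c + d}.
Proof. by move=> c d; rewrite /skew_scale !scalerDl. Qed.

HB.instance Definition _ := GRing.Zmodule_isLmodule.Build K R
  skew_scaleA skew_scale1 skew_scaleDr skew_scaleDl.

Lemma skewUM c d m n : skewU c m * skewU d n = skewU (c * pw m d) (m + n).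
Proof. exact: skew_mulUU. Qed.

Lemma skewUZ c d n : c *: skewU d n = skewU (c *: d) n.
Proof.
by apply/malgP => k; rewrite mcoeffZ !mcoeffU mulrnAr mulr_algl.
Qed.

Fact skew_scaleAl (c : K) (u v : R) : c *: (u * v) = (c *: u) * v.
Proof.
elim/skew_ind: u v => [|a m u IHu] v; first by rewrite !(mul0r, scaler0).
rewrite !(mulrDl, scalerDr) IHu; congr (_ + _).
elim/skew_ind: v => [|b n v IHv]; first by rewrite !(mulr0, scaler0).
rewrite !(mulrDr, scalerDr) IHv; congr (_ + _).
by rewrite skewUM !skewUZ skewUM scalerAl.
Qed.

HB.instance Definition _ := GRing.Lmodule_isLalgebra.Build K R skew_scaleAl.

Fact skew_scaleAr (c : K) (u v : R) : c *: (u * v) = u * (c *: v).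
Proof.
elim/skew_ind: u v => [|a m u IHu] v; first by rewrite !(mul0r, scaler0).
rewrite !(mulrDl, scalerDr) IHu; congr (_ + _).
elim/skew_ind: v => [|b n v IHv]; first by rewrite !(mulr0, scaler0).
rewrite !(mulrDr, scalerDr) IHv; congr (_ + _).
by rewrite skewUM !skewUZ skewUM linearZ scalerAr.
Qed.

HB.instance Definition _ := GRing.Lalgebra_isAlgebra.Build K R skew_scaleAr.

Definition skew_grade (n : int) : set R :=
  [set u | exists d : D, u = skewU d n].

End SkewZ.

Variant gwa_gen (D : Type) := GwaCoef of D | GwaXp | GwaXm.
Arguments GwaXp {D}.
Arguments GwaXm {D}.

Section GwaGen.
Variable D : choiceType.

Let encode (x : gwa_gen D) : D + bool :=
  match x with GwaCoef d => inl d | GwaXp => inr true | GwaXm => inr false end.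
Let decode (x : D + bool) : gwa_gen D :=
  match x with inl d => GwaCoef d | inr true => GwaXp | inr false => GwaXm end.
Let encodeK : cancel encode decode. Proof. by case. Qed.

HB.instance Definition _ := Choice.copy (gwa_gen D) (can_type encodeK).

End GwaGen.

Section GWA.
Variables (K : fieldType) (D : comAlgType K) (s : kaut D) (a : D).
Local Notation F := (freeAlg K (gwa_gen D)).
Local Notation coef d := (@fgen K (gwa_gen D) (GwaCoef d)).
Local Notation Xp := (@fgen K (gwa_gen D) GwaXp).
Local Notation Xm := (@fgen K (gwa_gen D) GwaXm).

(* The generators are all the elements of D, X+ and X-.  The first three
   relations make d |-> coef d a morphism of K-algebras, so that the quotient
   is the algebra generated over D by X+ and X- with the last four relations.
   Centrality of a is automatic, D being commutative. *)
Variant gwa_rel : set F :=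
| gwa_rel_lin c d e : gwa_rel (coef (c *: d + e) - (c *: coef d + coef e))
| gwa_rel_mul d e : gwa_rel (coef (d * e) - coef d * coef e)
| gwa_rel_one : gwa_rel (coef 1 - 1)
| gwa_rel_Xp d : gwa_rel (Xp * coef d - coef (s d) * Xp)
| gwa_rel_Xm d : gwa_rel (Xm * coef d - coef (kaut_inv s d) * Xm)
| gwa_rel_XmXp : gwa_rel (Xm * Xp - coef a)
| gwa_rel_XpXm : gwa_rel (Xp * Xm - coef (s a)).

(* Only used to see that the quotient is not trivial: X+ acts as e and X- as
   a e^-1. *)
Definition gwa_in_skew (x : gwa_gen D) : skewZ s :=
  match x with
  | GwaCoef d => skewU s d 0
  | GwaXp => skewU s 1 1
  | GwaXm => skewU s a (-1)
  end.

Lemma gwa_in_skew_rel r : gwa_rel r -> feval gwa_in_skew r = 0.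
Proof.
have subE u v : feval gwa_in_skew u = feval gwa_in_skew v ->
  feval gwa_in_skew (u - v) = 0 by rewrite fevalB => ->; rewrite subrr.
have gen x : feval gwa_in_skew (fgen K x) = gwa_in_skew x by exact: feval_gen.
case=> [c d e|d e||d|d||]; apply: subE.
- by rewrite fevalD feval_scalable !gen /= skewUD skewUZ.
- by rewrite fevalM !gen skewUM.
- by rewrite feval1 gen.
- by rewrite [LHS]fevalM [RHS]fevalM !gen !skewUM /= mul1r mulr1.
- by rewrite [LHS]fevalM [RHS]fevalM !gen !skewUM /= mulrC.
- by rewrite fevalM !gen skewUM /= rmorph1 mulr1.
- by rewrite fevalM !gen skewUM /= mul1r.
Qed.

Lemma gwa_proper : ~ ideal_gen gwa_rel 1.
Proof.
move=> /(ideal_gen_min gwa_in_skew_rel) /eqP.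
by rewrite rmorph1 oner_eq0.
Qed.

Definition gwa : Type := quotAlg gwa_proper.

HB.instance Definition _ := GRing.Algebra.on gwa.

Definition gwa_coef (d : D) : gwa := qpi gwa_proper (coef d).
Definition gwa_Xp : gwa := qpi gwa_proper Xp.
Definition gwa_Xm : gwa := qpi gwa_proper Xm.

Definition gwa_z (n : int) : gwa :=
  match n with Posz m => gwa_Xp ^+ m | Negz m => gwa_Xm ^+ m.+1 end.

Definition gwa_grade (n : int) : set gwa :=
  [set u | exists d : D, u = gwa_coef d * gwa_z n].

End GWA.

Arguments gwa_grade {K D} s a n.

Section FracMap.
Variables (R : idomainType) (f : {rmorphism R -> R}).
Hypothesis f_inj : injective f.
Local Notation "x %:F" := (tofrac x).

Definition frac_map (x : {fraction R}) : {fraction R} :=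
  (f (frac (repr x)).1)%:F / (f (frac (repr x)).2)%:F.

Fact frac_repr (x : {fraction R}) :
  x = ((frac (repr x)).1)%:F / ((frac (repr x)).2)%:F.
Proof.
have dx := denom_ratioP (repr x).
rewrite -[RHS]/(FracField.mul (FracField.tofrac _)
                  (FracField.inv (FracField.tofrac _))).
rewrite -[LHS]reprK !piE /FracField.mulf /FracField.invf.
by rewrite !numden_Ratio ?oner_eq0 // mulr1 mul1r Ratio_numden.
Qed.

Fact frac_map_wd (n d m e : R) : d != 0 -> e != 0 ->
  n%:F / d%:F = m%:F / e%:F -> (f n)%:F / (f d)%:F = (f m)%:F / (f e)%:F.
Proof.
move=> d0 e0 /eqP; rewrite eqr_div ?tofrac_eq0 // -!tofracM tofrac_eq => /eqP E.
apply/eqP; rewrite eqr_div ?tofrac_eq0 ?raddf_eq0 //.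
by rewrite -!tofracM tofrac_eq -!rmorphM E.
Qed.

Lemma frac_mapE n d : d != 0 -> frac_map (n%:F / d%:F) = (f n)%:F / (f d)%:F.
Proof.
move=> d0; apply: frac_map_wd => //; first exact: denom_ratioP.
exact/esym/frac_repr.
Qed.

Lemma fracP (x : {fraction R}) : exists n d, d != 0 /\ x = n%:F / d%:F.
Proof.
exists (frac (repr x)).1, (frac (repr x)).2; split; last exact: frac_repr.
exact: denom_ratioP.
Qed.

Lemma frac_map_tofrac n : frac_map n%:F = (f n)%:F.
Proof.
by have := frac_mapE n (oner_neq0 R); rewrite !rmorph1 !divr1.
Qed.

Fact frac_map_zmod_morphism : zmod_morphism frac_map.
Proof.
have fn0 e : e != 0 -> (f e)%:F != 0 by rewrite tofrac_eq0 raddf_eq0.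
move=> x y; have [n [d [d0 ->]]] := fracP x; have [m [e [e0 ->]]] := fracP y.
have sub (a b c g : R) : b%:F != 0 -> g%:F != 0 ->
    a%:F / b%:F - c%:F / g%:F = (a * g - c * b)%:F / (b * g)%:F.
  by move=> b0 g0; rewrite -mulNr addf_div // mulNr tofracB !tofracM.
rewrite sub ?tofrac_eq0 // !frac_mapE ?mulf_neq0 // sub ?fn0 //.
by rewrite rmorphB !rmorphM.
Qed.

Fact frac_map_monoid_morphism : monoid_morphism frac_map.
Proof.
split=> [|x y]; first by rewrite -tofrac1 frac_map_tofrac rmorph1.
have [n [d [d0 ->]]] := fracP x; have [m [e [e0 ->]]] := fracP y.
by rewrite mulf_div -!rmorphM !frac_mapE ?mulf_neq0 // mulf_div !rmorphM.
Qed.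

End FracMap.

Definition ratfun (K : fieldType) : Type := {fraction {poly K}}.

Section RatFun.
Variable K : fieldType.
Local Notation "x %:F" := (@tofrac {poly K} x).

HB.instance Definition _ := GRing.Field.on (ratfun K).

Definition ratfun_scale (c : K) (x : ratfun K) : ratfun K := (c%:P)%:F * x.

Fact ratfun_scaleA c d x :
  ratfun_scale c (ratfun_scale d x) = ratfun_scale (c * d) x.
Proof. by rewrite /ratfun_scale mulrA polyCM rmorphM. Qed.

Fact ratfun_scale1 : left_id 1 ratfun_scale.
Proof. by move=> x; rewrite /ratfun_scale !rmorph1 mul1r. Qed.

Fact ratfun_scaleDr : right_distributive ratfun_scale +%R.
Proof. by move=> c x y; rewrite /ratfun_scale mulrDr. Qed.

Fact ratfun_scaleDl x : {morph ratfun_scale^~ x : c d / c + d}.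
Proof. by move=> c d; rewrite /ratfun_scale !rmorphD mulrDl. Qed.

HB.instance Definition _ := GRing.Zmodule_isLmodule.Build K (ratfun K)
  ratfun_scaleA ratfun_scale1 ratfun_scaleDr ratfun_scaleDl.

Fact ratfun_scaleAl (c : K) (x y : ratfun K) : c *: (x * y) = (c *: x) * y.
Proof. exact: mulrA. Qed.

HB.instance Definition _ :=
  GRing.Lmodule_isLalgebra.Build K (ratfun K) ratfun_scaleAl.
HB.instance Definition _ := GRing.Lalgebra_isComAlgebra.Build K (ratfun K).

Definition ratfun_poly (p : {poly K}) : ratfun K := p%:F.

Variables (f : {lrmorphism {poly K} -> {poly K}}) (f_inj : injective f).

Definition ratfun_map of injective f : ratfun K -> ratfun K := frac_map f.

HB.instance Definition _ := GRing.isZmodMorphism.Build (ratfun K) (ratfun K)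
  (ratfun_map f_inj) (frac_map_zmod_morphism f_inj).
HB.instance Definition _ := GRing.isMonoidMorphism.Build (ratfun K) (ratfun K)
  (ratfun_map f_inj) (frac_map_monoid_morphism f_inj).

Lemma ratfun_map_poly p :
  ratfun_map f_inj (ratfun_poly p) = ratfun_poly (f p).
Proof. exact: frac_map_tofrac. Qed.

Fact ratfun_map_scalable : scalable (ratfun_map f_inj).
Proof.
move=> c x; rewrite [c *: x]/(ratfun_poly c%:P * x) rmorphM /= ratfun_map_poly.
by rewrite -alg_polyC linearZ /= rmorph1 alg_polyC.
Qed.

HB.instance Definition _ := GRing.isScalable.Build K (ratfun K) (ratfun K)
  *:%R (ratfun_map f_inj) ratfun_map_scalable.

End RatFun.

Lemma ratfun_mapK (K : fieldType) (f g : {lrmorphism {poly K} -> {poly K}})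
    (f_inj : injective f) (g_inj : injective g) :
  cancel f g -> cancel (ratfun_map f_inj) (ratfun_map g_inj).
Proof.
move=> fK x; have [n [d [d0 ->]]] := fracP x.
have fd0 : f d != 0 by rewrite -(raddf0 f) (inj_eq f_inj).
rewrite /ratfun_map (frac_mapE f_inj n d0).
rewrite [LHS](frac_mapE g_inj (f n) fd0).
by congr (tofrac _ / tofrac _); exact: fK.
Qed.

Section QAut.
Variables (K : fieldType) (q : K) (hq : q != 0).

Definition qdil (c : K) : {poly K} -> {poly K} := comp_poly (c *: 'X).

HB.instance Definition _ c :=
  GRing.LRMorphism.copy (qdil c) (comp_poly (c *: 'X)).

Fact qdilK c d : c * d = 1 -> cancel (qdil c) (qdil d).
Proof.
move=> cd1 p; rewrite /qdil -comp_polyA comp_polyZ comp_polyX scalerA cd1.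
by rewrite scale1r comp_polyXr.
Qed.

Definition qaut : kaut {poly K} :=
  KAut (qdilK (divff hq)) (qdilK (mulVf hq)).

Lemma qautX : qaut 'X = q *: 'X.
Proof. exact: comp_polyX. Qed.

Let qdil_inj := can_inj (qdilK (divff hq)).
Let qdilV_inj := can_inj (qdilK (mulVf hq)).

Definition qaut_frac : kaut (ratfun K) :=
  KAut (ratfun_mapK qdil_inj qdilV_inj (qdilK (divff hq)))
       (ratfun_mapK qdilV_inj qdil_inj (qdilK (mulVf hq))).

Lemma qaut_fracE (p r : {poly K}) : r != 0 ->
  qaut_frac (ratfun_poly p / ratfun_poly r)
    = ratfun_poly (p \Po (q *: 'X)) / ratfun_poly (r \Po (q *: 'X)).
Proof. exact: frac_mapE. Qed.

End QAut.

Section S1.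
Variables (K : fieldType) (q : K) (hq : q != 0).

Definition S1 : Type := skewZ (qaut_frac hq).

HB.instance Definition _ := GRing.Algebra.on S1.

Definition S1_grade : int -> set S1 := skew_grade (s := qaut_frac hq).

End S1.

Arguments S1_grade {K q} hq n.

Section QuantumPlane.
Variables (K : fieldType) (q : K).
Local Notation F := (freeAlg K bool).
Local Notation x := (@fgen K bool false).
Local Notation y := (@fgen K bool true).

Definition qplane_rel : set F := [set y * x - q *: (x * y)].

Lemma qplane_proper : ~ ideal_gen qplane_rel 1.
Proof.
have rel0 r : qplane_rel r -> feval (fun=> 0 : K^o) r = 0.
  move=> ->; rewrite fevalB feval_scalable !fevalM !feval_gen.
  by rewrite !mul0r scaler0 subr0.
by move=> /(ideal_gen_min rel0) /eqP; rewrite rmorph1 oner_eq0.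
Qed.

Definition qplane : Type := quotAlg qplane_proper.

HB.instance Definition _ := GRing.Algebra.on qplane.

Definition qplane_x : qplane := qpi qplane_proper x.
Definition qplane_y : qplane := qpi qplane_proper y.

Definition qplane_grade (n : int) : set qplane :=
  [set u | exists p : {poly K},
     u = horner_alg (qplane_x * qplane_y) p *
         match n with Posz m => qplane_y ^+ m | Negz m => qplane_x ^+ m.+1 end].

End QuantumPlane.

Arguments qplane_grade {K} q n.

(* The free algebra K<X | Z> is freeAlg K (int * nat): the variables of degree
   n are the pairs (n, i) with i : nat. *)
Definition graded_ids (K : fieldType) (B : algType K) (grade : int -> set B) :
    set (freeAlg K (int * nat)%type) :=
  [set f | forall phi : int * nat -> B,
     (forall v, grade v.1 (phi v)) -> feval phi f = 0].

(* Main.v *)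
Require Import Defs.
From HB Require Import structures.
From mathcomp Require Import all_boot all_order all_algebra.
From mathcomp Require Import finmap boolp classical_sets.
From mathcomp Require Import monalg.

Set Implicit Arguments.
Unset Strict Implicit.
Unset Printing Implicit Defensive.

Import GRing.Theory.
Local Open Scope ring_scope.

(** All three algebras live in the skew Laurent ring S = K(h)*Z, and in S a
    graded identity is a statement about commutative evaluation.  Substituting
    r_v e^n for each variable v of degree n turns a word v_1 ... v_k into the
    product of the s^(m_j)(r_(v_j)), times e^N, where m_j is the sum of the
    degrees of the letters before v_j and s dilates h by q.  So f is a graded
    identity of S if and only if, for every N, the resulting sum over the words
    of degree N ([graded_part] below) vanishes for all rational functions r_v.

    A generalized Weyl algebra of quantum type maps into K[h]*Z by X+ |-> e and
    X- |-> a e^-1.  It is spanned by the elements d z^n, and z^n goes to c_n e^n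
    with c_n nonzero, so the map is injective; its image in degree n is
    c_n K[h] e^n.  The quantum plane is the case a = h, with X+ = y, X- = x and
    h = xy; since it is given by other generators, the argument is made
    for any algebra generated by K[h], X+ and X- with the relations of the
    generalized Weyl algebra and mapped in this way to K[h]*Z
    ([graded_ids_gwa_presentation]).

    Identities of S thus restrict to these algebras.  For the converse
    ([graded_part_ratfun]) one has to pass from r_v in c_n K[h] to arbitrary
    rational functions.  Fix rational r_v and a nonzero x in K which avoids the
    finitely many zeros of the relevant denominators and of the c_n, shifted by
    powers of q.  As q is not a root of unity, the points q^m x are distinct,
    and interpolation gives polynomials p_v in c_n K[h] with the same values as
    the r_v at all points q^m x that occur in f.  The value at x of the rational
    function to be shown zero is therefore the value of the polynomial obtained
    from the p_v, which is zero.  This holds for all but finitely many x in the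
    infinite field K, so the rational function is zero. *)

(** * Words, shifts and the homogeneous components of an evaluation *)

Local Notation var := (int * nat)%type.

Definition wdeg (w : seq var) : int := \sum_(v <- w) v.1.

(** The letters of a word, each paired with the power of the automorphism that
    reaches its coefficient once the powers of e are collected on the right. *)
Fixpoint shifts (s : int) (w : seq var) : seq (var * int) :=
  if w is v :: w' then (v, s) :: shifts (s + v.1) w' else [::].

(** The coefficient of e^N in the evaluation of f, when y (v, m) is the image
    under the m-th power of the automorphism of the coefficient substituted for
    v.  Keeping y arbitrary allows to compare evaluations over different rings,
    and to evaluate at a point of K, where no automorphism acts. *)
Definition graded_part (K : fieldType) (D : algType K) (f : freeAlg K var)
    (N : int) (y : var * int -> D) : D :=
  \sum_(w <- msupp f | wdeg (w : {fmonom var}) == N)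
    f@_w *: \prod_(p <- shifts 0 (w : {fmonom var})) y p.

Lemma eq_graded_part (K : fieldType) (D : algType K) (f : freeAlg K var) N
    (y y' : var * int -> D) :
  (forall (w : {fmonom var}) p,
     w \in msupp f -> p \in shifts 0 w -> y p = y' p) ->
  graded_part f N y = graded_part f N y'.
Proof.
move=> yy'; rewrite /graded_part big_seq_cond [RHS]big_seq_cond.
apply: eq_bigr => w /andP[wf _]; congr (_ *: _).
by apply: eq_big_seq => p; exact: yy'.
Qed.

Section SkewEval.
Variables (K : fieldType) (D : algType K) (s : kaut D).

(** The factor e^n on the left makes the induction on w possible. *)
Lemma skewU_prod (r : var -> D) n (w : seq var) :
  skewU s 1 n * \prod_(v <- w) skewU s (r v) v.1
    = skewU s (\prod_(p <- shifts n w) kaut_pow s p.2 (r p.1)) (n + wdeg w).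
Proof.
elim: w n => [|v w IH] n; first by rewrite /wdeg !big_nil mulr1 addr0.
rewrite /wdeg !big_cons /= addrA mulrA.
have skewUE c m : skewU s c m = skewU s c 0 * skewU s 1 m.
  by rewrite skewUM mulr1 add0r.
rewrite skewUM mul1r skewUE.
by rewrite -mulrA IH skewUM add0r.
Qed.

Lemma feval_skew (r : var -> D) (f : freeAlg K var) N :
  (feval (fun v => skewU s (r v) v.1) f : {malg D[int]})@_N
    = graded_part f N (fun p => kaut_pow s p.2 (r p.1)).
Proof.
rewrite /feval mmapE raddf_sum /graded_part [RHS]big_mkcond /=.
apply: eq_bigr => w _; rewrite mulr_algl.
have := skewU_prod r 0 w; rewrite [skewU s 1 0]/(1 : skewZ s) mul1r add0r => ->.
rewrite skewUZ mcoeffU; by case: eqP.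
Qed.

Lemma graded_ids_skew (f : freeAlg K var) :
  graded_ids (skew_grade (s := s)) f <->
  forall (r : var -> D) N,
    graded_part f N (fun p => kaut_pow s p.2 (r p.1)) = 0.
Proof.
split=> [id_f r N|id_f phi grphi].
  by rewrite -feval_skew id_f ?mcoeff0 // => v; exists (r v).
have [r phiE] := choice grphi.
rewrite (_ : phi = fun v => skewU s (r v) v.1); last exact/funext.
by apply/malgP => N; rewrite feval_skew id_f mcoeff0.
Qed.

Lemma graded_part_morph (D' : algType K) (g : {lrmorphism D -> D'})
    (f : freeAlg K var) N (y : var * int -> D) :
  g (graded_part f N y) = graded_part f N (g \o y).
Proof.
rewrite raddf_sum; apply: eq_bigr => w _.
by rewrite /= linearZ rmorph_prod.
Qed.

End SkewEval.

(** * Values of rational functions *)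

Section RatfunPoly.
Variable K : fieldType.
Fact ratfun_poly_zmod_morphism : zmod_morphism (@ratfun_poly K).
Proof. exact: tofracB. Qed.
HB.instance Definition _ := GRing.isZmodMorphism.Build {poly K} (ratfun K)
  (@ratfun_poly K) ratfun_poly_zmod_morphism.
Fact ratfun_poly_monoid_morphism : monoid_morphism (@ratfun_poly K).
Proof. by split; [exact: tofrac1 | exact: tofracM]. Qed.
HB.instance Definition _ := GRing.isMonoidMorphism.Build {poly K} (ratfun K)
  (@ratfun_poly K) ratfun_poly_monoid_morphism.
Fact ratfun_poly_scalable : scalable (@ratfun_poly K).
Proof. by move=> c p; rewrite -mul_polyC; exact: tofracM. Qed.
HB.instance Definition _ := GRing.isScalable.Build K {poly K} (ratfun K)
  *:%R (@ratfun_poly K) ratfun_poly_scalable.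
End RatfunPoly.

Lemma interpolation (K : fieldType) (S : eqType) (t : S -> K) (g : S -> K)
    (xs : seq S) : injective t ->
  exists l : {poly K}, forall s, s \in xs -> l.[t s] = g s.
Proof.
move=> t_inj; elim: xs => [|a xs [l lE]]; first by exists 0.
have [axs|axs] := boolP (a \in xs).
  by exists l => s; rewrite inE => /predU1P[->|]; exact: lE.
pose m : {poly K} := \prod_(s <- xs) ('X - (t s)%:P).
have m0 s : s \in xs -> m.[t s] = 0.
  by move=> sxs; apply/rootP; rewrite /m -(big_map t predT (fun z => 'X - z%:P))
    root_prod_XsubC map_f.
have ma : m.[t a] != 0.
  rewrite -[_ == 0]/(root m (t a)).
  rewrite /m -(big_map t predT (fun z => 'X - z%:P)) root_prod_XsubC.
  by rewrite mem_map.
exists (l + ((g a - l.[t a]) / m.[t a]) *: m) => s.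
rewrite inE hornerD hornerZ => /predU1P[->|sxs].
  by rewrite divfK // addrC subrK.
by rewrite (m0 s) // mulr0 addr0 lE.
Qed.

Section Values.
Variable K : fieldType.

(** Evaluation at x is only defined on the rational functions regular at x.  As
    a relation, compatible with the algebra operations, it applies to an
    expression as soon as it applies to its leaves. *)
Definition takes_value (x : K) (r : ratfun K) (c : K) : Prop :=
  exists n d : {poly K},
    [/\ d.[x] != 0, r = ratfun_poly n / ratfun_poly d & c = n.[x] / d.[x]].

Lemma ratfun_poly_eq0 (p : {poly K}) : (ratfun_poly p == 0) = (p == 0).
Proof. exact: tofrac_eq0. Qed.

Lemma horner_neq0 (p : {poly K}) x : p.[x] != 0 -> p != 0.
Proof. by apply: contra => /eqP ->; rewrite horner0. Qed.

Lemma takes_value_poly x p : takes_value x (ratfun_poly p) p.[x].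
Proof.
by exists p, 1; rewrite hornerC oner_neq0 !divr1.
Qed.

Lemma takes_valueD x r r' c c' :
  takes_value x r c -> takes_value x r' c' -> takes_value x (r + r') (c + c').
Proof.
move=> [n [d [d0 -> ->]]] [n' [d' [d0' -> ->]]].
exists (n * d' + n' * d), (d * d'); rewrite !hornerE mulf_neq0 //; split=> //.
  rewrite addf_div ?ratfun_poly_eq0 ?(horner_neq0 d0) ?(horner_neq0 d0') //.
  by rewrite rmorphD !rmorphM.
by rewrite addf_div.
Qed.

Lemma takes_valueM x r r' c c' :
  takes_value x r c -> takes_value x r' c' -> takes_value x (r * r') (c * c').
Proof.
move=> [n [d [d0 -> ->]]] [n' [d' [d0' -> ->]]].
exists (n * n'), (d * d'); rewrite !hornerM mulf_neq0 //.
by rewrite !mulf_div !rmorphM.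
Qed.

Lemma takes_valueZ x a r c :
  takes_value x r c -> takes_value x (a *: r) (a * c).
Proof.
move=> rc; rewrite -[a *: r]/(ratfun_poly a%:P * r) -[X in X * c](hornerC a x).
exact/takes_valueM/rc/takes_value_poly.
Qed.

(** The converse of evaluating a fraction: the denominator d may vanish at x,
    so n and d are compared with the fraction that witnesses the value. *)
Lemma takes_value_num x n d : takes_value x (ratfun_poly n / ratfun_poly d) 0 ->
  d != 0 -> n.[x] = 0.
Proof.
move=> [m [e [e0 E mx0]]] d0; move/esym/eqP: mx0.
rewrite mulf_eq0 invr_eq0 (negPf e0) orbF => /eqP mx0; move/eqP: E.
rewrite eqr_div ?ratfun_poly_eq0 ?(horner_neq0 e0) //.
rewrite -!(rmorphM (@ratfun_poly K)).
rewrite [_ == _]tofrac_eq => /eqP /(congr1 (horner^~ x)) /eqP.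
by rewrite !hornerM mx0 mul0r mulf_eq0 (negPf e0) orbF => /eqP.
Qed.

Lemma takes_value_graded_part x (f : freeAlg K var) N
    (y : var * int -> ratfun K) (c : var * int -> K) :
  (forall w p, w \in msupp f -> p \in shifts 0 (w : {fmonom var}) ->
     takes_value x (y p) (c p)) ->
  takes_value x (graded_part f N y) (graded_part f N (c : _ -> K^o)).
Proof.
move=> yc; rewrite /graded_part.
rewrite !(big_mkcond (fun w : {fmonom var} => _ == _)) /=.
rewrite !big_seq; elim/big_rec2: _ => [|w u v wf uv].
  by rewrite -[X in takes_value x _ X](horner0 x); exact: takes_value_poly.
apply: takes_valueD => //; case: eqP => _; last first.
  by rewrite -[X in takes_value x _ X](horner0 x); exact: takes_value_poly.
apply: takes_valueZ; rewrite !big_seq; elim/big_rec2: _ => [|p a b pw ab].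
  by rewrite -[X in takes_value x _ X](hornerC 1 x); exact: takes_value_poly.
by apply: takes_valueM => //; exact: yc pw.
Qed.

End Values.

(** * Specialization of rational functions to polynomials *)

Section QDilation.
Variables (K : fieldType) (q : K) (hq : q != 0).
Local Notation sq := (qaut hq).
Local Notation sqf := (qaut_frac hq).

Lemma qaut_powE m (p : {poly K}) : kaut_pow sq m p = p \Po (q ^ m *: 'X).
Proof.
have iterE c n : iter n (qdil c) p = p \Po (c ^+ n *: 'X).
  elim: n => [|n IH]; first by rewrite scale1r comp_polyXr.
  by rewrite iterS IH /qdil -comp_polyA comp_polyZ comp_polyX scalerA exprSr.
by case: m => m; [exact: iterE | rewrite /exprz -exprVn; exact: iterE].
Qed.

Lemma horner_qaut_pow m (p : {poly K}) x :
  (kaut_pow sq m p).[x] = p.[q ^ m * x].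
Proof. by rewrite qaut_powE horner_comp hornerZ hornerX. Qed.

Lemma qaut_frac_pow_poly m (p : {poly K}) :
  kaut_pow sqf m (ratfun_poly p) = ratfun_poly (kaut_pow sq m p).
Proof.
case: m => m; rewrite /kaut_pow; [elim: m | elim: m.+1] => //= k ->;
exact: ratfun_map_poly.
Qed.

Lemma qaut_pow_eq0 m (p : {poly K}) : (kaut_pow sq m p == 0) = (p == 0).
Proof.
apply/eqP/eqP => [p0|->]; last by rewrite raddf0.
by rewrite -[p]/(kaut_pow sq 0 p) -(addNr m) kaut_powD p0 raddf0.
Qed.

Lemma takes_value_pow m x r c :
  takes_value (q ^ m * x) r c -> takes_value x (kaut_pow sqf m r) c.
Proof.
move=> [n [d [d0 -> ->]]]; exists (kaut_pow sq m n), (kaut_pow sq m d).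
rewrite !horner_qaut_pow -!qaut_frac_pow_poly; split=> //.
exact: (fmorph_div (kaut_pow sqf m : {rmorphism ratfun K -> ratfun K})).
Qed.

Hypothesis hroot : forall n : nat, (0 < n)%N -> q ^+ n != 1.

Lemma exprz_inj : injective (fun m : int => q ^ m).
Proof.
have ne1 (k : nat) : q ^ k = 1 -> k = 0%N.
  by case: k => // k /eqP; rewrite (negPf (hroot _)).
move=> m n /= E; apply/eqP; rewrite -subr_eq0.
have: q ^ (m - n) = 1 by rewrite expfzDr // -invr_expz E divff // expfz_neq0.
case: (m - n) => k; first by move/ne1 ->.
by rewrite NegzE -invr_expz => /eqP; rewrite invr_eq1 => /eqP/ne1.
Qed.

Lemma poly_eq0_horner (p : {poly K}) : (forall x, p.[x] = 0) -> p = 0.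
Proof.
(* The powers of q are more candidate roots than the degree allows. *)
move=> p0; apply/eqP/contraT => /max_poly_roots.
move=> /(_ [seq q ^ n%:Z | n <- iota 0 (size p)]).
rewrite size_map size_iota ltnn; apply.
  by apply/allP => x _; rewrite rootE p0.
by rewrite map_inj_uniq ?iota_uniq // => m n /exprz_inj [].
Qed.

(** The polynomials c n account for the image of a generalized Weyl algebra in
    K[h]*Z being only c n K[h] in degree n. *)
Lemma graded_part_ratfun (f : freeAlg K var) N (c : int -> {poly K}) :
    (forall n, c n != 0) ->
    (forall l : var -> {poly K},
      graded_part f N (fun p => kaut_pow sq p.2 (c p.1.1 * l p.1)) = 0) ->
  forall r : var -> ratfun K,
    graded_part f N (fun p => kaut_pow sqf p.2 (r p.1)) = 0.
Proof.
move=> c0 fl r.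
have [n nP] := choice (fun v => fracP (r v)); have [d ndP] := choice nP.
(* The finitely many pairs (variable, shift) on which graded_part f depends. *)
pose O := [seq p | w <- enum_fset (msupp f), p <- shifts 0 (w : {fmonom var})].
have inO (w : {fmonom var}) p : w \in msupp f -> p \in shifts 0 w -> p \in O.
  by move=> wf pw; apply/allpairsPdep; exists w, p.
pose b p := kaut_pow sq p.2 (d p.1 * c p.1.1).
(* Points where this polynomial is nonzero are good points for interpolation:
   no relevant denominator or c n vanishes, and x <> 0 makes the q^m x
   distinct.  Multiplying by it removes the bad points from consideration. *)
have G0 : 'X * \prod_(p <- O) b p != 0.
  rewrite mulf_neq0 ?polyX_eq0 // prodf_seq_neq0; apply/allP => p _.
  by rewrite qaut_pow_eq0 mulf_neq0 //; case: (ndP p.1).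
set R := graded_part _ _ _.
have [N0 [D0 [D00 RE]]] := fracP R.
suff: N0 * ('X * \prod_(p <- O) b p) = 0.
  move/eqP; rewrite mulf_eq0 (negPf G0) orbF RE => /eqP ->.
  by rewrite tofrac0 mul0r.
apply: poly_eq0_horner => x; apply/eqP; rewrite hornerM mulf_eq0.
rewrite hornerM hornerX horner_prod mulf_eq0 orbCA.
have [//|x0 /=] := eqVneq x 0.
have [bx|bx] := boolP (\prod_(p <- O) (b p).[x] == 0); rewrite ?orbT // orbF.
have {}bx p : p \in O -> (d p.1).[q ^ p.2 * x] * (c p.1.1).[q ^ p.2 * x] != 0.
  move: bx; rewrite prodf_seq_neq0 => /allP bx /bx /=.
  by rewrite /b horner_qaut_pow hornerM.
apply/eqP; apply: takes_value_num D00.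
pose t m := q ^ m * x.
have t_inj : injective t by move=> i j /(mulIf x0) /exprz_inj.
pose val p := (n p.1).[t p.2] / (d p.1).[t p.2].
have [l lP] : exists l : var -> {poly K}, forall p, p \in O ->
    (l p.1).[t p.2] = val p / (c p.1.1).[t p.2].
  have lP v := interpolation (fun m => val (v, m) / (c v.1).[t m])
    [seq p.2 | p <- O] t_inj.
  have [l lP'] := choice lP; exists l => -[v m] vmO /=.
  by rewrite lP' //; apply/mapP; exists (v, m).
(* Both sides agree with the polynomial evaluation at x: the rational functions
   by definition of val, the polynomials c n * l v by interpolation. *)
have <- : graded_part f N (val : _ -> K^o) = 0.
  rewrite -[RHS](horner0 x) -[in RHS](fl l).
  rewrite -[RHS]/(horner_eval x (graded_part _ _ _)).
  rewrite (graded_part_morph (horner_eval x : {lrmorphism {poly K} -> K^o})).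
  apply: eq_graded_part => w p wf pw; have pO := inO _ _ wf pw.
  rewrite /= /horner_eval horner_qaut_pow hornerM lP // mulrC divfK //.
  by have := bx _ pO; rewrite mulf_eq0 negb_or => /andP[].
rewrite -RE; apply: takes_value_graded_part => w p wf pw.
apply: takes_value_pow; have [dv ->] := ndP p.1.
exists (n p.1), (d p.1).
have/bx := inO _ _ wf pw.
by rewrite mulf_eq0 negb_or => /andP[].
Qed.

End QDilation.

(** * Free algebras and their quotients *)

Lemma feval_morph (K : fieldType) (X : choiceType) (B C : algType K)
    (g : {lrmorphism B -> C}) (phi : X -> B) (f : freeAlg K X) :
  g (feval phi f) = feval (g \o phi) f.
Proof.
rewrite /feval !mmapE raddf_sum; apply: eq_bigr => w _ /=.
by rewrite !mulr_algl linearZ rmorph_prod.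
Qed.

Lemma freeAlg_ind (K : fieldType) (X : choiceType) (P : freeAlg K X -> Prop) :
  P 1 -> (forall u v, P u -> P v -> P (u + v)) ->
  (forall c u, P u -> P (c *: u)) -> (forall x u, P u -> P (fgen K x * u)) ->
  forall u, P u.
Proof.
move=> P1 PD PZ PM u; rewrite [u]monalgE.
apply: big_ind => // [|w _].
  by rewrite -(scale0r (1 : freeAlg K X)); exact: PZ.
have -> : << u@_w *g w >> = u@_w *: (<< w >> : freeAlg K X).
  by apply/malgP => k; rewrite mcoeffZ !mcoeffU mulr_natr.
apply: PZ; case: w => w; elim: w => [|x w IH].
  by rewrite -fmoneE.
rewrite (_ : << _ >> = fgen K x * << FMonom w >>); first exact: PM.
rewrite -[RHS]/(fgmul << fmu x >> << FMonom w >>) fgmulUU mulr1.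
by congr << _ >>; rewrite fmuE [RHS]fmmulE.
Qed.

Lemma quot_lift (K : fieldType) (A B : algType K) (S : set A)
    (nt : ~ ideal_gen S 1) (f : {lrmorphism A -> B}) :
  (forall s, S s -> f s = 0) ->
  exists g : {lrmorphism quotAlg nt -> B}, forall u, g (qpi nt u) = f u.
Proof.
move=> fS; have [rep repE] := choice (@qpi_surj _ _ _ nt).
have repK u : f (rep (qpi nt u)) = f u.
  have /qpi_eq /(ideal_gen_min fS) := esym (repE (qpi nt u)).
  by rewrite rmorphB => /subr0_eq.
pose g x := f (rep x).
have gB : zmod_morphism g.
  move=> x y; rewrite [in LHS](repE x) [in LHS](repE y) -rmorphB /g repK.
  by rewrite rmorphB.
have gM : monoid_morphism g.
  split=> [|x y]; first by rewrite /g -(rmorph1 (qpi nt)) repK rmorph1.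
  by rewrite [in LHS](repE x) [in LHS](repE y) -rmorphM /g repK rmorphM.
have gZ : scalable g.
  by move=> c x; rewrite [in LHS](repE x) -linearZ /g repK linearZ.
pose ga := GRing.isZmodMorphism.Build _ _ g gB.
pose gm := GRing.isMonoidMorphism.Build _ _ g gM.
pose gs := GRing.isScalable.Build K _ _ *:%R g gZ.
pose G : {lrmorphism quotAlg nt -> B} := HB.pack g ga gm gs.
by exists G.
Qed.

(** * Algebras satisfying the relations of a generalized Weyl algebra *)

(** Generation of B is stated as an induction principle, the form in which both
    presentations provide it.  That the relations imply no others in B is
    expressed by the morphism psi to K[h]*Z. *)
Section GwaPresentation.
Variables (K : fieldType) (q : K) (hq : q != 0) (a : {poly K}) (a0 : a != 0).
Local Notation sq := (qaut hq).
Variables (B : algType K) (coef : {additive {poly K} -> B}) (Xp Xm : B).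
Variable psi : {lrmorphism B -> skewZ sq}.
Hypotheses (coef1 : coef 1 = 1)
  (coefM : forall d e, coef (d * e) = coef d * coef e)
  (XpC : forall d, Xp * coef d = coef (sq d) * Xp)
  (XmC : forall d, Xm * coef d = coef (kaut_inv sq d) * Xm)
  (XmXp : Xm * Xp = coef a) (XpXm : Xp * Xm = coef (sq a)).
Hypothesis B_ind : forall P : B -> Prop, P 1 ->
  (forall u v, P u -> P v -> P (u + v)) ->
  (forall d u, P u -> P (coef d * u)) ->
  (forall u, P u -> P (Xp * u)) -> (forall u, P u -> P (Xm * u)) ->
  forall u, P u.
Hypotheses (psi_coef : forall d, psi (coef d) = skewU sq d 0)
  (psi_Xp : psi Xp = skewU sq 1 1) (psi_Xm : psi Xm = skewU sq a (-1)).

Let z (n : int) : B :=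
  match n with Posz m => Xp ^+ m | Negz m => Xm ^+ m.+1 end.

Variable grade : int -> set B.
Hypothesis gradeE : forall n u, grade n u <-> exists d, u = coef d * z n.

(** The span of the d z^n contains 1 and is stable under the left
    multiplications by the generators: X+ and X- move z^n to a neighbour, up to
    a factor a or s(a) when they cancel. *)
Lemma homogeneous_span u : exists g : {malg {poly K}[int]}, u = mmap coef z g.
Proof.
have hom d n : exists g : {malg {poly K}[int]}, coef d * z n = mmap coef z g.
  by exists << d *g n >>; rewrite mmapU.
have add u' v : (exists g : {malg {poly K}[int]}, u' = mmap coef z g) ->
  (exists g : {malg {poly K}[int]}, v = mmap coef z g) ->
  (exists g : {malg {poly K}[int]}, u' + v = mmap coef z g).
  by move=> [g ->] [g' ->]; exists (g + g'); rewrite mmapD.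
have mul x : (forall d n, exists g, x * (coef d * z n) = mmap coef z g) ->
    forall u', (exists g : {malg {poly K}[int]}, u' = mmap coef z g) ->
    exists g : {malg {poly K}[int]}, x * u' = mmap coef z g.
  move=> xh _ [g ->]; rewrite mmapE mulr_sumr; elim/big_ind: _ => //.
  by exists 0; rewrite mmap0.
elim/B_ind: u => //.
- by exists << 1 *g 0 >>; rewrite mmapU coef1 mul1r.
- by move=> d; apply: mul => e n; rewrite mulrA -coefM.
- apply: mul => d n; rewrite mulrA XpC -mulrA.
  case: n => [n|n]; first by rewrite -exprS; exact: (hom _ n.+1).
  rewrite [z _]exprS (mulrA Xp) XpXm mulrA -coefM.
  case: n => [|n]; first exact: (hom _ 0).
  exact: (hom _ (Negz n)).
apply: mul => d n; rewrite mulrA XmC -mulrA.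
case: n => [[|n]|n].
  by rewrite -[z 0]/(Xm ^+ 0) -exprS; exact: (hom _ (Negz 0)).
  by rewrite [z _]exprS (mulrA Xm) XmXp mulrA -coefM; exact: (hom _ n).
by rewrite -exprS; exact: (hom _ (Negz n.+1)).
Qed.

Lemma psi_z n : exists c : {poly K}, c != 0 /\ psi (z n) = skewU sq c n.
Proof.
case: n => n.
  rewrite /z; elim: n => [|n [c [c0 IH]]].
    by exists 1; rewrite oner_neq0 rmorph1.
  exists (sq c); rewrite exprS rmorphM /= psi_Xp IH skewUM.
  by rewrite mul1r -[sq c]/(kaut_pow sq 1 c) qaut_pow_eq0.
suff XmE m : exists c : {poly K}, c != 0 /\ psi (Xm ^+ m) = skewU sq c (- m%:Z).
  by rewrite NegzE; exact: (XmE n.+1).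
elim: m => [|m [c [c0 IH]]]; first by exists 1; rewrite oner_neq0 rmorph1.
exists (a * kaut_pow sq (-1) c); rewrite mulf_neq0 ?qaut_pow_eq0 //.
by rewrite exprS rmorphM /= psi_Xm IH skewUM intS opprD.
Qed.

Lemma psi_homogeneous n : exists c : {poly K}, c != 0 /\
  forall d, psi (coef d * z n) = skewU sq (c * d) n.
Proof.
have [c [c0 cE]] := psi_z n; exists c; split=> // d.
by rewrite rmorphM /= psi_coef cE skewUM add0r mulrC.
Qed.

(** Elements of distinct degrees have images with disjoint supports, and the
    domain K[h] has no zero divisors, so each component d of the preimage can be
    read off from c n * d. *)
Lemma psi_inj u : psi u = 0 -> u = 0.
Proof.
have [c cP] := choice psi_homogeneous.
have [g ->] := homogeneous_span u; rewrite mmapE raddf_sum => E.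
rewrite big1_seq // => n /andP[_ ng].
suff -> : g@_n = 0 by rewrite raddf0 mul0r.
have := congr1 (fun w : {malg {poly K}[int]} => w@_n) E.
rewrite mcoeff0 raddf_sum (big_fsetD1 n) //= (cP n).2 mcoeffUU big1_fset.
  by move/eqP; rewrite addr0 mulf_eq0 (negPf (cP n).1) => /eqP.
by move=> m; rewrite !inE (cP m).2 mcoeffU => /andP[/negPf ->].
Qed.

Hypothesis hroot : forall n : nat, (0 < n)%N -> q ^+ n != 1.

Lemma graded_ids_gwa_presentation : graded_ids grade = graded_ids (S1_grade hq).
Proof.
have [c cP] := choice psi_homogeneous.
have psiE (l : var -> {poly K}) (f : freeAlg K var) N :
    (psi (feval (fun v => coef (l v) * z v.1) f) : {malg {poly K}[int]})@_N
    = graded_part f N (fun p => kaut_pow sq p.2 (c p.1.1 * l p.1)).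
  rewrite -(feval_skew sq (fun v => c v.1 * l v)) feval_morph.
  rewrite (_ : psi \o _ = fun v => skewU sq (c v.1 * l v) v.1) //.
  by apply/funext => v; exact: (cP v.1).2.
apply/seteqP; split=> f.
  move=> fB; apply/graded_ids_skew => r N.
  apply: (graded_part_ratfun hroot (fun n => (cP n).1)) => l.
  rewrite -psiE fB ?raddf0 // => v; apply/gradeE; by exists (l v).
move=> /graded_ids_skew fS phi grphi; apply: psi_inj.
have [l lP] := choice (fun v => (gradeE _ _).1 (grphi v)).
have -> : phi = fun v => coef (l v) * z v.1 by apply/funext.
apply/malgP => N; rewrite psiE mcoeff0; apply/eqP.
rewrite -ratfun_poly_eq0; apply/eqP.
rewrite -(fS (fun v => ratfun_poly (c v.1 * l v)) N).
rewrite (graded_part_morph (@ratfun_poly K)); congr graded_part.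
by apply/funext => p; rewrite /= qaut_frac_pow_poly.
Qed.

End GwaPresentation.

(** * Generalized Weyl algebras of quantum type and the quantum plane *)

Section Gwa.
Variables (K : fieldType) (q : K) (hq : q != 0) (a : {poly K}).
Local Notation sq := (qaut hq).
Local Notation coef := (gwa_coef sq a).
Local Notation Xp := (gwa_Xp sq a).
Local Notation Xm := (gwa_Xm sq a).
Local Notation proper := (@gwa_proper _ _ sq a).

Fact gwa_coef_linear : linear coef.
Proof.
move=> c d e; rewrite /gwa_coef -linearP; apply/qpi_eq/ideal_gen_in.
exact: gwa_rel_lin.
Qed.

HB.instance Definition _ :=
  GRing.isLinear.Build K {poly K} (gwa sq a) *:%R coef gwa_coef_linear.

Lemma gwa_ind (P : gwa sq a -> Prop) : P 1 ->
  (forall u v, P u -> P v -> P (u + v)) ->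
  (forall d u, P u -> P (coef d * u)) ->
  (forall u, P u -> P (Xp * u)) -> (forall u, P u -> P (Xm * u)) ->
  forall u, P u.
Proof.
move=> P1 PD Pc Pp Pm u; have [v ->] := @qpi_surj _ _ _ proper u.
elim/freeAlg_ind: v => [|v w Pv Pw|c v Pv|[d||] v Pv].
- by rewrite rmorph1.
- by rewrite rmorphD; apply: PD.
- have coef1 : coef 1 = 1.
    by rewrite -(rmorph1 (qpi proper)); apply/qpi_eq/ideal_gen_in/gwa_rel_one.
  by rewrite linearZ /= -mulr_algl -coef1 -linearZ; apply: Pc.
- by rewrite rmorphM; apply: Pc.
- by rewrite rmorphM; apply: Pp.
- by rewrite rmorphM; apply: Pm.
Qed.

Lemma graded_ids_gwa (hroot : forall n : nat, (0 < n)%N -> q ^+ n != 1) :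
  a != 0 -> graded_ids (gwa_grade sq a) = graded_ids (S1_grade hq).
Proof.
move=> a0; have [psi psiE] := quot_lift proper
  (f := feval (gwa_in_skew sq a)) (@gwa_in_skew_rel _ _ sq a).
have rel u v : gwa_rel sq a (u - v) ->
    qpi proper u = qpi proper v.
  by move=> r; apply/qpi_eq/ideal_gen_in.
apply: (graded_ids_gwa_presentation a0 (coef := coef) (Xp := Xp) (Xm := Xm)
  (psi := psi)).
- by rewrite -[RHS](rmorph1 (qpi proper)); apply/rel/gwa_rel_one.
- by move=> d e; rewrite -(rmorphM (qpi proper)); apply/rel/gwa_rel_mul.
- by move=> d; rewrite -!(rmorphM (qpi proper)); apply/rel/gwa_rel_Xp.
- by move=> d; rewrite -!(rmorphM (qpi proper)); apply/rel/gwa_rel_Xm.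
- by rewrite -(rmorphM (qpi proper)); apply/rel/gwa_rel_XmXp.
- by rewrite -(rmorphM (qpi proper)); apply/rel/gwa_rel_XpXm.
- exact: gwa_ind.
- by move=> d; rewrite psiE; exact: feval_gen.
- by rewrite psiE; exact: feval_gen.
- by rewrite psiE; exact: feval_gen.
- by move=> n u; split=> -[d ->]; exists d.
- exact: hroot.
Qed.

End Gwa.

Lemma horner_alg_skew_comm (K : fieldType) (B : algType K) (w t : B) (c : K)
    (p : {poly K}) :
  t * w = c *: (w * t) ->
  t * horner_alg w p = horner_alg w (p \Po (c *: 'X)) * t.
Proof.
move=> twE; elim/poly_ind: p => [|p b IH].
  by rewrite comp_poly0 !raddf0 mulr0 mul0r.
rewrite comp_polyD comp_polyM comp_polyX comp_polyC !rmorphD !rmorphM /=.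
rewrite linearZ /= horner_algX !horner_algC mulrDr mulrDl.
rewrite mulr_algr !mulr_algl; congr (_ + _).
by rewrite mulrA IH -!mulrA -scalerAl twE.
Qed.

Section QuantumPlane.
Variables (K : fieldType) (q : K) (hq : q != 0).
Local Notation sq := (qaut hq).
Local Notation x := (qplane_x q).
Local Notation y := (qplane_y q).
Local Notation proper := (@qplane_proper _ q).

Lemma qplane_yx : y * x = q *: (x * y).
Proof.
by rewrite -!rmorphM -linearZ; apply/qpi_eq/ideal_gen_in.
Qed.

(** The embedding of the generalized Weyl algebra with a = h, whose X- = x goes
    to h e^-1; then xy goes to h. *)
Definition qplane_in_skew (b : bool) : skewZ sq :=
  if b then skewU sq 1 1 else skewU sq 'X (-1).

Lemma qplane_in_skew_rel r : qplane_rel q r -> feval qplane_in_skew r = 0.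
Proof.
have gen b : feval qplane_in_skew (fgen K b) = qplane_in_skew b.
  exact: feval_gen.
move=> ->; apply: etrans (fevalB _ _ _) _.
apply/eqP; rewrite subr_eq0; apply/eqP.
apply: etrans (fevalM _ _ _) _; apply/esym.
apply: etrans (feval_scalable _ _ _) _.
apply: etrans (congr1 _ (fevalM _ _ _)) _.
rewrite !gen !skewUM skewUZ mul1r rmorph1 mulr1.
by rewrite -[kaut_pow sq 1 'X]/(sq 'X) qautX.
Qed.

Lemma qplane_ind (P : qplane q -> Prop) : P 1 ->
  (forall u v, P u -> P v -> P (u + v)) -> (forall c u, P u -> P (c *: u)) ->
  (forall u, P u -> P (y * u)) -> (forall u, P u -> P (x * u)) ->
  forall u, P u.
Proof.
move=> P1 PD PZ Py Px u; have [v ->] := @qpi_surj _ _ _ proper u.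
elim/freeAlg_ind: v => [|v w Pv Pw|c v Pv|[] v Pv].
- by rewrite rmorph1.
- by rewrite rmorphD; apply: PD.
- by rewrite linearZ; apply: PZ.
- by rewrite rmorphM; apply: Py.
- by rewrite rmorphM; apply: Px.
Qed.

(** The quantum plane is an instance of the relations above with coefficients
    K[xy], X+ = y, X- = x and a = h: indeed xy = h and yx = q h = s(h). *)
Lemma graded_ids_qplane
    (hroot : forall n : nat, (0 < n)%N -> q ^+ n != 1) :
  graded_ids (qplane_grade q) = graded_ids (S1_grade hq).
Proof.
have [psi psiE] := quot_lift proper
  (f := feval qplane_in_skew) qplane_in_skew_rel.
have psi_x : psi x = skewU sq 'X (-1) by rewrite psiE; exact: feval_gen.
have psi_y : psi y = skewU sq 1 1 by rewrite psiE; exact: feval_gen.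
have X0 : ('X : {poly K}) != 0 by rewrite polyX_eq0.
apply: (graded_ids_gwa_presentation X0 (coef := horner_alg (x * y))
  (Xp := y) (Xm := x) (psi := psi)).
- exact: rmorph1.
- exact: rmorphM.
- move=> d; apply: horner_alg_skew_comm.
  by rewrite mulrA qplane_yx -scalerAl.
- move=> d; apply: horner_alg_skew_comm.
  by rewrite -(mulrA x y x) qplane_yx -scalerAr scalerA mulVf // scale1r.
- by rewrite /= horner_algX.
- by rewrite qplane_yx qautX /= linearZ /= horner_algX mulr_algl.
- move=> P P1 PD Pc; apply: qplane_ind => // c u /(Pc c%:P) /=.
  by rewrite horner_algC mulr_algl.
- elim/poly_ind=> [|p c IH]; first by rewrite !raddf0 skewU0.
  rewrite /= in IH *; rewrite !rmorphD !rmorphM /=.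
  rewrite horner_algX horner_algC rmorphM /= IH.
  rewrite psi_x psi_y linearZ /= rmorph1 !skewUM.
  rewrite -[X in c *: X]/(skewU sq 1 0) skewUZ skewUD alg_polyC.
  by rewrite !rmorph1 !mulr1.
- exact: psi_y.
- exact: psi_x.
- by move=> n u; split=> -[d ->]; exists d.
- exact: hroot.
Qed.

End QuantumPlane.

Theorem corollary39 (K : fieldType) (hK : [pchar K] =i pred0) (q : K)
    (hq : q != 0) (hroot : forall n : nat, (0 < n)%N -> q ^+ n != 1)
    (a : {poly K}) (ha : a != 0) :
  graded_ids (gwa_grade (qaut hq) a) = graded_ids (S1_grade hq)
  /\ graded_ids (S1_grade hq) = graded_ids (qplane_grade q).
Proof.
by rewrite graded_ids_gwa // (graded_ids_qplane hq).
Qed.
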